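(* Let $A\in\mathbb{R}^{n\times n}$ be a symmetric matrix with spectrum $\sigma(A)\subset[\lambda_{\min},\lambda_{\max}]$, let $\boldsymbol{b}\in\mathbb{R}^n$ be nonzero, and let $f$ be analytic on an open set containing $[\lambda_{\min},\lambda_{\max}]$ and real-valued on $[\lambda_{\min},\lambda_{\max}]$. Let $\psi=\boldsymbol{b}^Tf(A)\boldsymbol{b}$, let $\psi_m=\|\boldsymbol{b}\|_2^2\,\boldsymbol{e}_1^Tf(A_m)\boldsymbol{e}_1$ be its rational Krylov approximation after $m$ iterations with $\xi_m=\infty$, and let $g_m$ be the function defined in the context from the corresponding rational Arnoldi decomposition. Then $$\|\boldsymbol{b}\|_2^2\min_{z\in[\lambda_{\min},\lambda_{\max}]}|g_m(z)|\leq|\psi-\psi_m|\leq\|\boldsymbol{b}\|_2^2\max_{z\in[\lambda_{\min},\lambda_{\max}]}|g_m(z)|.$$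
   Context: Rational Krylov subspaces. Let $m\ge 1$ and let the poles $\xi_1,\dots,\xi_{m-1}\in(\mathbb{R}\cup\{\infty\})\setminus(\sigma(A)\cup\{0\})$ and $\xi_m=\infty$ be given. For $1\le j\le m+1$ let $q_{j-1}(z)=\prod_{i=1}^{j-1}(1-z/\xi_i)$ (with $z/\infty=0$) and $$\mathcal{Q}_j(A,\boldsymbol{b})=\{q_{j-1}(A)^{-1}p(A)\boldsymbol{b}: p\in\Pi_{j-1}\},$$ where $\Pi_k$ is the set of polynomials of degree at most $k$. Rational Arnoldi decomposition. The rational Arnoldi algorithm gives a real matrix $V_{m+1}=[\boldsymbol{v}_1\,\cdots\,\boldsymbol{v}_{m+1}]$ with orthonormal columns, $\boldsymbol{v}_1=\boldsymbol{b}/\|\boldsymbol{b}\|_2$ and $\mathrm{span}\{\boldsymbol{v}_1,\dots,\boldsymbol{v}_j\}=\mathcal{Q}_j(A,\boldsymbol{b})$ for $1\le j\le m+1$ (so these spaces have full dimension $j$), and real $(m+1)\times m$ upper Hessenberg matrices $\underline{K_m},\underline{H_m}$ of full rank with $$AV_{m+1}\underline{K_m}=V_{m+1}\underline{H_m}.$$ Since $\xi_m=\infty$, the last row of $\underline{K_m}$ is zero. Let $V_m=[\boldsymbol{v}_1\,\cdots\,\boldsymbol{v}_m]$, let $K_m,H_m$ be the leading $m\times m$ principal blocks of $\underline{K_m},\underline{H_m}$ ($K_m$ is then nonsingular), and let $\boldsymbol{h}_{m+1}^T=h_{m+1,m}\boldsymbol{e}_m^T$ be the last row of $\underline{H_m}$.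 Then $AV_m=V_mA_m+\boldsymbol{v}_{m+1}\boldsymbol{h}_{m+1}^TK_m^{-1}$ with $A_m=V_m^TAV_m=H_mK_m^{-1}$. Matrix functions of a symmetric matrix are defined by applying $f$ to the eigenvalues in a spectral decomposition; $\boldsymbol{e}_j$ denotes the $j$-th canonical basis vector. Definition of $g_m$. Let $A_m=U_mD_mU_m^T$ be a spectral decomposition with $U_m$ orthogonal and $D_m=\mathrm{diag}(\theta_1,\dots,\theta_m)$ (the $\theta_j$ are pairwise distinct and lie in $[\lambda_{\min},\lambda_{\max}]$). Define $$[\alpha_1,\dots,\alpha_m]=\boldsymbol{h}_{m+1}^TK_m^{-1}U_m,\qquad[\beta_1,\dots,\beta_m]^T=U_m^T\boldsymbol{e}_1,\qquad\gamma_j=\sum_{\ell\neq j}\frac{\alpha_\ell\beta_\ell}{\theta_j-\theta_\ell},$$ and $g_m(z)=\sum_{j=1}^m g_m^{(j)}(z)$, where $$g_m^{(j)}(z)=\begin{cases}\alpha_j^2\beta_j^2\left(\dfrac{f(z)-f(\theta_j)}{(z-\theta_j)^2}-\dfrac{f'(\theta_j)}{z-\theta_j}\right)+2\alpha_j\beta_j\gamma_j\dfrac{f(z)-f(\theta_j)}{z-\theta_j}&\text{if }z\neq\theta_j,\\[2mm]\dfrac12\alpha_j^2\beta_j^2f''(\theta_j)+2\alpha_j\beta_j\gamma_jf'(\theta_j)&\text{if }z=\theta_j.\end{cases}$$ *)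

(* Defs.v *)
From HB Require Import structures.
From mathcomp Require Import all_boot all_order all_algebra complex.
From mathcomp Require Import all_classical all_reals all_analysis.

Set Implicit Arguments.
Unset Strict Implicit.
Unset Printing Implicit Defensive.

Import Order.TTheory GRing.Theory Num.Theory.
Import numFieldNormedType.Exports.

Local Open Scope classical_set_scope.
Local Open Scope ring_scope.
Local Open Scope complex_scope.

(* The topology, limits and derivatives of the library live on an abstract
   [C : numFieldType]; definitions that need them are stated at that level and
   used at [C := R[i]], where derivatives are complex derivatives. *)
Definition analytic_at (C : numFieldType) (f : C -> C) (z : C) : Prop :=
  exists a : nat -> C, exists2 r : C, 0 < r &
    forall w : C, `|w - z| < r ->
      series (fun k => a k * (w - z) ^+ k) @ \oo --> f w.

Definition analytic_around (C : numFieldType) (S : set C) (f : C -> C) : Prop :=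
  exists U : set C,
    [/\ open U, S `<=` U & forall z : C, U z -> analytic_at f z].

(* [spectralmx], [spectral_diag] give a unitary spectral decomposition of the
   complexification of A (normal, as A is only used symmetric). *)
Definition mxfun (R : realType) (f : R[i] -> R[i]) (n : nat) (A : 'M[R]_n) :
    'M[R[i]]_n :=
  let AC := map_mx (real_complex R) A in
  invmx (spectralmx AC) *m diag_mx (map_mx f (spectral_diag AC))
    *m spectralmx AC.

(* v^T f(A) v *)
Definition mxfun_quad (R : realType) (f : R[i] -> R[i]) (n : nat)
    (A : 'M[R]_n) (v : 'cV[R]_n) : R[i] :=
  let vC := map_mx (real_complex R) v in (vC^T *m mxfun f A *m vC) 0 0.

Definition norm2 (R : rcfType) (n : nat) (v : 'cV[R]_n) : R :=
  Num.sqrt (\sum_i v i 0 ^+ 2).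

Definition e1 (R : pzRingType) (m : nat) : 'cV[R]_m :=
  \col_(i < m) (i == 0 :> nat)%:R.

(* Poles are elements of R + {oo}: [None] is oo, and z / oo = 0.  They are
   indexed from 0: [xi i] is the (i+1)-st pole. *)
Definition pole_inv (R : fieldType) (x : option R) : R :=
  if x is Some y then y^-1 else 0.

Definition pole_poly (R : fieldType) (m : nat) (xi : 'I_m -> option R)
    (k : nat) : {poly R} :=
  \prod_(i < m | (i < k)%N) (1 - pole_inv (xi i) *: 'X).

(* For 0 < j, [size p <= j] says that p has degree at most j - 1. *)
Definition rat_krylov (R : fieldType) (n m : nat) (A : 'M[R]_n.+1)
    (b : 'cV[R]_n.+1) (xi : 'I_m -> option R) (j : nat) : set 'cV[R]_n.+1 :=
  [set x | exists2 p : {poly R}, (size p <= j)%N &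
     x = invmx (horner_mx A (pole_poly xi j.-1)) *m horner_mx A p *m b].

Definition upper_hessenberg (R : nmodType) (p q : nat) (M : 'M[R]_(p, q)) :
    Prop :=
  forall (i : 'I_p) (j : 'I_q), (j.+1 < i)%N -> M i j = 0.

(* [rad_K_last] is the property of the algorithm's output for a last pole oo. *)
Record rat_arnoldi_decomp (R : rcfType) (n m : nat) (A : 'M[R]_n.+1)
    (b : 'cV[R]_n.+1) (xi : 'I_m -> option R) (V : 'M[R]_(n.+1, m + 1))
    (K H : 'M[R]_(m + 1, m)) : Prop := {
  rad_orthonormal : V^T *m V = 1%:M;
  rad_first : V *m e1 R (m + 1) = (norm2 b)^-1 *: b;
  rad_span : forall j : nat, (0 < j <= m + 1)%N -> forall x : 'cV[R]_n.+1,
    x \in <<[seq col i V | i : 'I_(m + 1) <- enum 'I_(m + 1) & (i < j)%N]>>%VS <->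
    rat_krylov A b xi j x;
  rad_K_hessenberg : upper_hessenberg K;
  rad_H_hessenberg : upper_hessenberg H;
  rad_K_rank : \rank K = m;
  rad_H_rank : \rank H = m;
  rad_eq : A *m V *m K = V *m H;
  rad_K_last : dsubmx K = 0
}.

Section ErrorFunction.
Variables (C : numFieldType) (f : C -> C) (m : nat).
Variables (alpha beta theta : 'I_m -> C).

Definition gamma_coef (j : 'I_m) : C :=
  \sum_(l < m | l != j) alpha l * beta l / (theta j - theta l).

Definition gm_term (j : 'I_m) (z : C) : C :=
  let t := theta j in
  let ab := alpha j * beta j in
  if z != t then
    alpha j ^+ 2 * beta j ^+ 2
      * ((f z - f t) / (z - t) ^+ 2 - derive1 f t / (z - t))
    + 2 * ab * gamma_coef j * ((f z - f t) / (z - t))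
  else
    2^-1 * (alpha j ^+ 2 * beta j ^+ 2) * derive1n 2 f t
    + 2 * ab * gamma_coef j * derive1 f t.

Definition gm (z : C) : C := \sum_(j < m) gm_term j z.
End ErrorFunction.

(* Main.v *)
Require Import Defs.
From HB Require Import structures.
From mathcomp Require Import all_boot all_order all_algebra complex.
From mathcomp Require Import all_classical all_reals all_analysis.
From mathcomp Require Import ring lra.

Set Implicit Arguments.
Unset Strict Implicit.
Unset Printing Implicit Defensive.

Import Order.TTheory GRing.Theory Num.Theory.
Import numFieldNormedType.Exports.

(** The residual of the Ritz approximation lives in one direction.  With
    [v] the last basis vector and [y_j = Vm *m U e_j] the Ritz vectors, the
    decomposition gives [A y_j = theta_j y_j + alpha_j v].  Expand everything
    in an orthonormal eigenbasis of [A]; let [d_i], [y_ij] be the coordinates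
    of [v], [y_j] along the [i]-th eigenvector, of eigenvalue [l_i].  Then
    [(l_i - theta_j) y_ij = d_i alpha_j], and [Vm e_1 = \sum_j beta_j y_j] has
    coordinate [c_i = d_i phi(l_i)] with
    [phi(x) = \sum_j alpha_j beta_j / (x - theta_j)], as long as no [l_i] is a
    Ritz value.

    The function [gm] is [f phi^2] with the principal parts of its poles at
    the [theta_j] removed, so
    [c_i^2 f(l_i) = d_i^2 gm(l_i) + (terms in f(theta_j) and f'(theta_j))].
    Summed over [i], the orthogonality of [v] to the Ritz vectors kills all of
    these terms except [\sum_j f(theta_j) beta_j^2], which is the Krylov
    approximation.  Hence the error is [|b|^2 \sum_i d_i^2 gm(l_i)]
    ([rational_krylov_error]).  The case
    [l_i = theta_j] is covered as well, because then [d_i = 0].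

    That last point and the distinctness of the [theta_j] rest on the fact
    that the range of [Vm] contains no eigenvector of [A]
    ([krylov_no_eigenvector]): an eigenvector [q(A)^-1 p(A) b] would yield a
    nonzero polynomial of degree at most [m] annihilating [b], against the
    full dimension of the last Krylov space.

    Finally the weights [d_i^2] are nonnegative of sum 1, so the error divided
    by [|b|^2] is a weighted mean of values of [gm].  On the interval [gm] is
    real and continuous; its removable singularities at the [theta_j] are
    controlled by a second order Taylor bound extracted from the power series
    of [f] ([analytic_taylor2]).  The mean is thus a value [gm(z0)], which
    lies between the extreme values of [|gm|] in absolute value. *)

Local Open Scope classical_set_scope.
Local Open Scope ring_scope.

(** * The error identity in eigenvector coordinates *)

(** For [j != l] the product of two simple fractions splits by
    [1 / ((x - s) (x - t)) = (1 / (x - s) - 1 / (x - t)) / (s - t)]; by the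
    symmetry in [j] and [l] the two halves contribute equally, whence the
    factor 2. *)
Lemma sqr_sum_partial_fractions (F : fieldType) (m : nat)
    (a theta : 'I_m -> F) (x : F) :
  injective theta -> (forall j, x != theta j) ->
  (\sum_j a j / (x - theta j)) ^+ 2 =
  \sum_j (a j ^+ 2 / (x - theta j) ^+ 2
    + 2 * a j * (\sum_(l < m | l != j) a l / (theta j - theta l))
      / (x - theta j)).
Proof.
move=> injt xt.
have xt0 j : x - theta j != 0 by rewrite subr_eq0.
(* The half of the split product of the terms [j], [l] with pole [theta j]. *)
pose G j l := a j * a l / (theta j - theta l) / (x - theta j).
have offdiag : \sum_j \sum_(l < m | l != j)
    (a j / (x - theta j)) * (a l / (x - theta l)) =
    \sum_j \sum_(l < m | l != j) 2 * G j l.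
  transitivity (\sum_j \sum_(l < m | l != j) (G j l + G l j)).
    apply: eq_bigr => j _; apply: eq_bigr => l lj.
    have tjl : theta j - theta l != 0.
      by rewrite subr_eq0; apply: contra lj => /eqP/injt->.
    have tlj : theta l - theta j != 0 by rewrite -oppr_eq0 opprB.
    by rewrite /G; field; rewrite !xt0 tjl tlj.
  under eq_bigr do rewrite big_split /=.
  rewrite big_split /= [X in _ + X](exchange_big_dep predT) //= -big_split /=.
  apply: eq_bigr => j _.
  rewrite [X in _ + X](eq_bigl (fun l => l != j)); last first.
    by move=> l; rewrite eq_sym.
  by rewrite -big_split /=; apply: eq_bigr => l _; rewrite mulr_natl mulr2n.
rewrite expr2 big_distrl /=.
transitivity (\sum_j ((a j / (x - theta j)) ^+ 2 + \sum_(l < m | l != j)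
   (a j / (x - theta j)) * (a l / (x - theta l)))).
  apply: eq_bigr => j _; by rewrite big_distrr /= (bigD1 j) //= expr2.
rewrite big_split /= offdiag -big_split /=; apply: eq_bigr => j _.
rewrite expr_div_n; congr (_ + _).
rewrite big_distrr /= big_distrl /=.
apply: eq_bigr => l _; rewrite /G; ring.
Qed.

(** The contribution of one eigenvector, of eigenvalue [lam]: [d] and [y j]
    are its components in the residual direction and in the [j]-th Ritz
    vector.  If [d != 0] then [lam] is no Ritz value and the identity is the
    partial fraction expansion of [phi^2]; if [d = 0] then [y j] vanishes
    unless [theta j = lam], so at most one term survives on each side. *)
Lemma spectral_term_identity (C : numClosedFieldType) (f : C -> C) (m : nat)
    (alpha beta theta : 'I_m -> C) (lam d : C) (y : 'I_m -> C) :
  (forall j, alpha j \is Num.real) -> (forall j, beta j \is Num.real) ->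
  (forall j, theta j \is Num.real) -> lam \is Num.real ->
  (forall j, alpha j != 0) -> injective theta ->
  (forall j, (lam - theta j) * y j = d * alpha j) ->
  let c := \sum_j y j * beta j in
  c * c^* * f lam = d * d^* * gm f alpha beta theta lam
    + \sum_j (f (theta j) * (beta j ^+ 2 * (y j * (y j)^*)
        + 2 * gamma_coef alpha beta theta j * beta j * (d^* * y j))
      + derive1 f (theta j) * (alpha j * beta j ^+ 2) * (d^* * y j)).
Proof.
move=> ra rb rt rl a0 injt yE c.
have [d0|dn0] := eqVneq d 0.
  have yor j : (y j == 0) || (lam == theta j).
    have := yE j; rewrite d0 mul0r => /eqP; rewrite mulf_eq0 subr_eq0.
    by rewrite orbC.
  rewrite d0 !mul0r add0r /c rmorph_sum /= big_distrl /= big_distrl /=.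
  apply: eq_bigr => j _.
  rewrite conjC0 !mul0r !mulr0 !addr0.
  have [->|yj0] := eqVneq (y j) 0; first by rewrite !(mul0r, mulr0).
  have /eqP lt : lam == theta j by have := yor j; rewrite (negPf yj0).
  rewrite (bigD1 j) //= big1 ?addr0; last first.
    move=> l lj; have /orP[/eqP->|/eqP lt'] := yor l.
      by rewrite mul0r conjC0.
    by case/eqP: lj; apply: injt; rewrite -lt -lt'.
  rewrite rmorphM /= (CrealP (rb j)) lt; ring.
have ln j : lam - theta j != 0.
  apply/negP => /eqP e; have /eqP := yE j; rewrite e mul0r eq_sym mulf_eq0.
  by rewrite (negPf dn0) (negPf (a0 j)).
have yj j : y j = d * (alpha j / (lam - theta j)).
  by rewrite mulrA -yE mulrAC mulfV ?mul1r.
pose a j := alpha j * beta j.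
have cE : c = d * \sum_j a j / (lam - theta j).
  rewrite /c big_distrr; apply: eq_bigr => j _; rewrite yj /a /=; ring.
have sr : (\sum_j a j / (lam - theta j)) \is Num.real.
  apply: rpred_sum => j _; rewrite rpredM ?rpredM ?rpredV //.
  by rewrite rpredB.
have -> : c * c^* * f lam =
    d * d^* * ((\sum_j a j / (lam - theta j)) ^+ 2 * f lam).
  rewrite cE rmorphM /= (CrealP sr); ring.
rewrite sqr_sum_partial_fractions//; last by move=> j; rewrite -subr_eq0.
rewrite /gm big_distrl /= !big_distrr /= -big_split /=.
apply: eq_bigr => j _.
rewrite /gm_term /gamma_coef -[lam == theta j]subr_eq0 (ln j).
set gam := \sum_(l < m | _) _.
have -> : (y j)^* = d^* * (alpha j / (lam - theta j)).
  rewrite yj rmorphM /=; congr (_ * _); apply/CrealP.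
  by rewrite rpredM ?rpredV ?rpredB.
rewrite yj /a; field; exact: ln.
Qed.

(** Summing the identities over the eigenvectors: every term that carries the
    factor [(d i)^* * y i j] cancels, by orthogonality of the residual
    direction to the Ritz vectors. *)
Lemma spectral_error_sum (C : numClosedFieldType) (f : C -> C) (n m : nat)
    (alpha beta theta : 'I_m -> C) (lam d : 'I_n -> C) (y : 'I_n -> 'I_m -> C) :
  (forall j, alpha j \is Num.real) -> (forall j, beta j \is Num.real) ->
  (forall j, theta j \is Num.real) -> (forall i, lam i \is Num.real) ->
  (forall j, alpha j != 0) -> injective theta ->
  (forall i j, (lam i - theta j) * y i j = d i * alpha j) ->
  (forall j, \sum_i y i j * (d i)^* = 0) ->
  (forall j, \sum_i y i j * (y i j)^* = 1) ->
  let c i := \sum_j y i j * beta j in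
  \sum_i f (lam i) * (c i * (c i)^*) - \sum_j f (theta j) * beta j ^+ 2 =
  \sum_i d i * (d i)^* * gm f alpha beta theta (lam i).
Proof.
move=> ra rb rt rl a0 injt yE yd yy c.
under eq_bigr do
  rewrite mulrC (spectral_term_identity f ra rb rt (rl _) a0 injt (yE _)).
rewrite big_split /= exchange_big /= -addrA -sumrB [X in _ + X]big1.
  by rewrite addr0.
move=> j _.
rewrite big_split /= -!mulr_sumr big_split /= -!mulr_sumr yy.
under eq_bigr do rewrite mulrC.
by rewrite yd !mulr0 !addr0 mulr1 subrr.
Qed.

(** * Krylov spaces and the Arnoldi relation *)

Lemma pole_poly_unit (F : fieldType) (n m : nat) (A : 'M[F]_n.+1)
    (xi : 'I_m -> option F) (k : nat) :
  (forall i x, xi i = Some x -> x != 0 /\ ~~ eigenvalue A x) ->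
  horner_mx A (pole_poly xi k) \in unitmx.
Proof.
move=> hxi; rewrite /pole_poly rmorph_prod /=.
apply: (big_ind (fun M : 'M[F]_n.+1 => M \in unitmx)) => [|M N uM uN|i _].
- exact: unitmx1.
- by rewrite unitmx_mul uM.
case: (xi i) (hxi i) => [x|] /=; last first.
  by move=> _; rewrite scale0r subr0 rmorph1 unitmx1.
case/(_ x erefl) => x0; rewrite /eigenvalue negbK kermx_eq0 row_free_unit.
move=> uAx; rewrite rmorphB rmorph1 /= horner_mxZ horner_mx_X.
have -> : 1 - x^-1 *: A = (- x^-1) *: (A - x%:M).
  rewrite scalerBr scale_scalar_mx mulNr mulVf // scaleNr.
  by rewrite raddfN /= opprK addrC.
by rewrite unitmxZ // unitrN unitrV unitfE.
Qed.

(** The rational functions spanning the last Krylov space are the images of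
    [m + 1] coefficient vectors under [Q *m W], whose range contains the
    [m + 1] orthonormal columns of [V]; so [Q *m W] is injective. *)
Lemma krylov_annihilator0 (F : fieldType) (n m : nat) (A : 'M[F]_n.+1)
    (b : 'cV[F]_n.+1) (xi : 'I_m -> option F) (V : 'M[F]_(n.+1, m + 1))
    (r : {poly F}) :
  V^T *m V = 1%:M -> (forall i, rat_krylov A b xi (m + 1) (col i V)) ->
  (size r <= m + 1)%N -> horner_mx A r *m b = 0 -> r = 0.
Proof.
move=> VV hV sr rb0.
pose Q := invmx (horner_mx A (pole_poly xi (m + 1).-1)).
pose W : 'M[F]_(n.+1, m + 1) := \matrix_(i, k) (A ^+ k *m b) i 0.
have WE (p : {poly F}) : (size p <= m + 1)%N ->
    horner_mx A p *m b = W *m \col_k p`_k.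
  move=> sp.
  have {1}-> : p = \sum_(k < m + 1) p`_k *: 'X^k.
    rewrite -poly_def; apply/polyP => i; rewrite coef_poly.
    by case: ltnP => // /(leq_trans sp) /(nth_default 0).
  rewrite rmorph_sum /= mulmx_suml; apply/colP => i.
  rewrite summxE [RHS]mxE; apply: eq_bigr => k _.
  by rewrite horner_mxZ rmorphXn /= horner_mx_X -scalemxAl !mxE mulrC.
have /fin_all_exists[c cE] i : exists ci, col i V = Q *m W *m ci.
  by have [p sp ->] := hV i; exists (\col_k p`_k); rewrite -!mulmxA WE.
have VE : V = Q *m W *m \matrix_(k, i) c i k 0.
  apply/matrixP => k i; have /colP/(_ k) := cE i; rewrite !mxE => ->.
  by apply: eq_bigr => l _; rewrite !mxE.
have := VV; rewrite {2}VE mulmxA => /mulmx1C; rewrite !mulmxA => CVQW.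
apply/polyP => k; rewrite coef0.
have [km|] := ltnP k (m + 1); last by move/(leq_trans sr)/(nth_default 0).
suff : \col_(l < m + 1) r`_l = 0 by move/colP/(_ (Ordinal km)); rewrite !mxE.
by rewrite -[LHS]mul1mx -CVQW -[LHS]mulmxA -WE // rb0 mulmx0.
Qed.

(** Write [x = q(A)^-1 p(A) b].  If [A x = t x] then [(X - t) p], of degree
    at most [m], annihilates [b]. *)
Lemma krylov_no_eigenvector (F : fieldType) (n m : nat) (A : 'M[F]_n.+1)
    (b : 'cV[F]_n.+1) (xi : 'I_m -> option F) (V : 'M[F]_(n.+1, m + 1))
    (t : F) (x : 'cV[F]_n.+1) :
  (forall i x, xi i = Some x -> x != 0 /\ ~~ eigenvalue A x) ->
  V^T *m V = 1%:M -> (forall i, rat_krylov A b xi (m + 1) (col i V)) ->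
  rat_krylov A b xi m x -> A *m x = t *: x -> x = 0.
Proof.
move=> hxi VV hV [p sp xE] Ax.
pose Q := horner_mx A (pole_poly xi m.-1).
have uQ : Q \in unitmx by exact: pole_poly_unit.
have Qx : Q *m x = horner_mx A p *m b by rewrite xE mulmxA mulKVmx.
have rp : horner_mx A (('X - t%:P) * p) *m b = 0.
  rewrite rmorphM /= rmorphB /= horner_mx_X horner_mx_C.
  rewrite -[_ * _ *m b]mulmxA -Qx mulmxA.
  have -> : (A - t%:M) *m Q = Q *m (A - t%:M).
    apply: comm_mx_horner; apply/comm_mx_sym/comm_mxB => //.
    by apply/comm_mx_scalar.
  by rewrite -mulmxA mulmxBl mul_scalar_mx Ax subrr mulmx0.
have /eqP : ('X - t%:P) * p = 0.
  apply: (krylov_annihilator0 VV hV) => //.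
  rewrite (leq_trans (size_polyMleq _ _)) // size_XsubC /= addn1.
  by rewrite ltnS.
rewrite mulf_eq0 polyXsubC_eq0 /= => /eqP p0.
by rewrite -[x](mulKmx uQ) Qx p0 rmorph0 mul0mx mulmx0.
Qed.

Lemma rad_range_krylov (R : rcfType) (n m : nat) (A : 'M[R]_n.+1)
    (b : 'cV[R]_n.+1) (xi : 'I_m -> option R) (V : 'M[R]_(n.+1, m + 1))
    (K H : 'M[R]_(m + 1, m)) (y : 'cV[R]_m) :
  (0 < m)%N -> rat_arnoldi_decomp A b xi V K H ->
  rat_krylov A b xi m (lsubmx V *m y).
Proof.
move=> m0 hrad; apply: (rad_span hrad _ _).1; first by rewrite m0 leq_addr.
have -> : lsubmx V *m y = \sum_j y j 0 *: col (lshift 1 j) V.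
  apply/colP => i; rewrite mxE summxE; apply: eq_bigr => j _.
  by rewrite !mxE mulrC.
apply: memv_suml => j _; apply/memvZ/memv_span/mapP; exists (lshift 1 j) => //.
by rewrite mem_filter /= ltn_ord mem_enum.
Qed.

Lemma rad_col_krylov (R : rcfType) (n m : nat) (A : 'M[R]_n.+1)
    (b : 'cV[R]_n.+1) (xi : 'I_m -> option R) (V : 'M[R]_(n.+1, m + 1))
    (K H : 'M[R]_(m + 1, m)) :
  rat_arnoldi_decomp A b xi V K H ->
  forall i, rat_krylov A b xi (m + 1) (col i V).
Proof.
move=> hrad i; apply: (rad_span hrad _ _).1; first by rewrite addn1 leqnn.
apply/memv_span/mapP; exists i => //.
by rewrite mem_filter /= ltn_ord mem_enum.
Qed.

Lemma rad_orthonormal_blocks (R : rcfType) (n m : nat) (A : 'M[R]_n.+1)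
    (b : 'cV[R]_n.+1) (xi : 'I_m -> option R) (V : 'M[R]_(n.+1, m + 1))
    (K H : 'M[R]_(m + 1, m)) :
  rat_arnoldi_decomp A b xi V K H ->
  [/\ (lsubmx V)^T *m lsubmx V = 1%:M, (lsubmx V)^T *m rsubmx V = 0,
      (rsubmx V)^T *m lsubmx V = 0 & (rsubmx V)^T *m rsubmx V = 1%:M].
Proof.
move=> hrad; have := rad_orthonormal hrad.
rewrite -{1 2}(hsubmxK V) tr_row_mx mul_col_row scalar_mx_block.
by case/eq_block_mx.
Qed.

(** Since the last row of [K] vanishes, the decomposition can be solved for
    [A *m Vm]; multiplying by [Vm^T] identifies the coefficient of [Vm]. *)
Lemma rad_mul_basis (R : rcfType) (n m : nat) (A : 'M[R]_n.+1)
    (b : 'cV[R]_n.+1) (xi : 'I_m -> option R) (V : 'M[R]_(n.+1, m + 1))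
    (K H : 'M[R]_(m + 1, m)) :
  rat_arnoldi_decomp A b xi V K H ->
  A *m lsubmx V = lsubmx V *m ((lsubmx V)^T *m A *m lsubmx V)
    + rsubmx V *m (dsubmx H *m invmx (usubmx K)).
Proof.
move=> hrad; set Vm := lsubmx V; set v := rsubmx V.
have KE : K = col_mx (usubmx K) 0 by rewrite -(rad_K_last hrad) vsubmxK.
have VE : V = row_mx Vm v by rewrite hsubmxK.
have uK : usubmx K \in unitmx.
  rewrite -row_free_unit -row_leq_rank -{1}(rad_K_rank hrad) {1}KE.
  by rewrite -addsmxE addsmx0.
have [VV Vv _ _] := rad_orthonormal_blocks hrad.
have AV : A *m Vm = Vm *m (usubmx H *m invmx (usubmx K))
    + v *m (dsubmx H *m invmx (usubmx K)).
  have := rad_eq hrad; rewrite {1 2}VE {1}KE -mulmxA mul_row_col mulmx0 addr0.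
  rewrite -[in RHS](vsubmxK H) mul_row_col mulmxA.
  move/(congr1 (mulmx^~ (invmx (usubmx K)))).
  by rewrite mulmxK // mulmxDl -!mulmxA.
rewrite -[(Vm^T *m _) *m _]mulmxA {2}AV [in Vm^T *m _]mulmxDr.
by rewrite ![Vm^T *m (_ *m _)]mulmxA VV Vv mul1mx mul0mx addr0.
Qed.

Lemma rad_start (R : rcfType) (n m : nat) (A : 'M[R]_n.+1)
    (b : 'cV[R]_n.+1) (xi : 'I_m -> option R) (V : 'M[R]_(n.+1, m + 1))
    (K H : 'M[R]_(m + 1, m)) :
  (0 < m)%N -> b != 0 -> rat_arnoldi_decomp A b xi V K H ->
  b = norm2 b *: (lsubmx V *m e1 R m).
Proof.
move=> m0 b0 hrad.
have nb : norm2 b != 0.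
  apply: contra b0; rewrite /norm2 sqrtr_eq0 => le0; apply/eqP/colP => i.
  have sq0 (k : 'I_n.+1) : true -> 0 <= b k 0 ^+ 2 by rewrite sqr_ge0.
  have /eqP : \sum_i b i 0 ^+ 2 == 0 by rewrite eq_le le0 sumr_ge0.
  by move/(psumr_eq0P sq0)/(_ i isT)/eqP; rewrite sqrf_eq0 mxE => /eqP.
have -> : lsubmx V *m e1 R m = V *m e1 R (m + 1).
  have -> : e1 R (m + 1) = col_mx (e1 R m) 0.
    apply/colP => i; rewrite [RHS]mxE; case: (splitP i) => [j ij|j ij];
      rewrite !mxE ij //.
    by rewrite addn_eq0 (gtn_eqF m0).
  by rewrite -{2}(hsubmxK V) mul_row_col mulmx0 addr0.
by rewrite (rad_first hrad) scalerA mulfV // scale1r.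
Qed.

(** * Functions of real symmetric matrices *)

Lemma symmetricmxP (R : fieldType) (n : nat) (A : 'M[R]_n) :
  reflect (A^T = A) (A \is symmetricmx).
Proof.
apply: (iffP (is_hermitianmxP _ _ _)); rewrite expr0 scale1r map_mx_id //.
Qed.

Local Notation "M ^t*" := (map_mx Num.conj M^T) (at level 30).

Local Notation toC := (map_mx (real_complex _)).

Section RealSpectral.
Variable R : realType.
Local Notation C := R[i]%C.

Lemma conj_real_complex (x : R) : (x%:C%C)^* = x%:C%C :> C.
Proof. by apply/CrealP; apply/complex_realP; exists x. Qed.

Lemma toC_conj p q (M : 'M[R]_(p, q)) : map_mx Num.conj (toC M) = toC M.
Proof. by apply/matrixP => i j; rewrite !mxE conj_real_complex. Qed.

Lemma hermsymmx_toC n (A : 'M[R]_n) : A \is symmetricmx ->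
  toC A \is hermsymmx.
Proof.
move/is_hermitianmxP; rewrite expr0 scale1r map_mx_id // => AT.
apply/is_hermitianmxP; rewrite expr0 scale1r.
by rewrite map_trmx toC_conj {1}AT.
Qed.

(** A function of a matrix can be computed from any diagonalization: the change
    of basis between two of them is zero wherever the eigenvalues differ, so
    it also intertwines the two diagonal matrices of values of [f]. *)
Lemma mxfun_diag (f : C -> C) n (A : 'M[R]_n) (P : 'M[C]_n) (d : 'rV[C]_n) :
  A \is symmetricmx -> P \in unitmx ->
  toC A = invmx P *m diag_mx d *m P ->
  mxfun f A = invmx P *m diag_mx (map_mx f d) *m P.
Proof.
move=> sA uP AE; rewrite /mxfun.
set Q := spectralmx _; set e := spectral_diag _.
have uQ : Q \in unitmx by exact: spectral_unit.
have AQ : toC A = invmx Q *m diag_mx e *m Q.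
  exact/orthomx_spectralP/hermitian_normalmx/hermsymmx_toC.
have : diag_mx e *m (Q *m invmx P) = Q *m invmx P *m diag_mx d.
  have : Q *m toC A *m invmx P = Q *m toC A *m invmx P by [].
  rewrite {1}AQ AE !mulmxA mulmxV // mul1mx.
  by rewrite -!mulmxA mulmxV // mulmx1 !mulmxA.
move=> comm.
have fcomm : diag_mx (map_mx f e) *m (Q *m invmx P)
    = Q *m invmx P *m diag_mx (map_mx f d).
  apply/matrixP => i j; have /matrixP/(_ i j) := comm.
  rewrite !mul_diag_mx !mul_mx_diag !mxE; set t := \sum_(k < n) _.
  have [->|t0] := eqVneq t 0; first by rewrite !(mulr0, mul0r).
  by rewrite mulrC => /(mulfI t0) ->; rewrite mulrC.
rewrite -[RHS]mul1mx -[1%:M](mulVmx uQ) -!mulmxA; congr (_ *m _).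
rewrite [Q *m _]mulmxA [RHS]mulmxA -fcomm -!mulmxA mulVmx // mulmx1.
by [].
Qed.

Lemma mxfun_quad_diag (f : C -> C) n (A : 'M[R]_n) (P : 'M[C]_n)
    (d : 'rV[C]_n) (v : 'cV[R]_n) :
  A \is symmetricmx -> P \is unitarymx -> toC A = P ^t* *m diag_mx d *m P ->
  mxfun_quad f A v =
    \sum_i f (d 0 i) * ((P *m toC v) i 0 * ((P *m toC v) i 0)^*).
Proof.
move=> sA uP AE.
rewrite /mxfun_quad (mxfun_diag f sA (unitarymx_unit uP) (d := d))
  ?invmx_unitary //.
have -> : (toC v)^T *m (P ^t* *m diag_mx (map_mx f d) *m P) *m toC v =
    (P *m toC v) ^t* *m (diag_mx (map_mx f d) *m (P *m toC v)).
  by rewrite trmx_mul map_mxM map_trmx toC_conj !mulmxA.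
rewrite mxE; apply: eq_bigr => i _.
by rewrite mul_diag_mx !mxE mulrCA [X in _ * X]mulrC.
Qed.

Lemma unitary_dot n (P : 'M[C]_n) (v w : 'cV[R]_n) : P \is unitarymx ->
  \sum_i (P *m toC w) i 0 * ((P *m toC v) i 0)^* = ((v^T *m w) 0 0)%:C%C.
Proof.
move=> uP.
have PP : P ^t* *m P = 1%:M by rewrite -invmx_unitary// mulVmx// unitarymx_unit.
transitivity (((P *m toC v) ^t* *m (P *m toC w)) 0 0).
  by rewrite [RHS]mxE; apply: eq_bigr => i _; rewrite !mxE mulrC.
rewrite trmx_mul map_mxM map_trmx toC_conj -mulmxA (mulmxA _ P) PP mul1mx.
by rewrite -map_mxM mxE.
Qed.

(** The spectral decomposition is taken over the complex numbers; its
    eigenvalues are real because the matrix is Hermitian, and a real eigenvalue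
    of the complexification is an eigenvalue of the real matrix. *)
Lemma spectral_diag_toC n (A : 'M[R]_n) : A \is symmetricmx ->
  exists2 l : 'I_n -> R, (forall i, eigenvalue A (l i)) &
    (forall i, spectral_diag (toC A) 0 i = (l i)%:C%C).
Proof.
move=> sA; have hA := hermsymmx_toC sA.
have AQ := orthomx_spectralP (hermitian_normalmx hA).
have /mxOverP sr := hermitian_spectral_diag_real hA.
have uQ := spectral_unit (toC A).
exists (fun i => complex.Re (spectral_diag (toC A) 0 i)) => i; last first.
  by rewrite RRe_real.
rewrite -(eigenvalue_map (real_complex R)) /= RRe_real //.
apply/eigenvalueP; exists (row i (spectralmx (toC A))); last first.
  apply/eqP => r0; have /row_unitarymxP/(_ i i) := spectral_unitarymx (toC A).
  by rewrite r0 linear0l eqxx => /eqP; rewrite eq_sym oner_eq0.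
rewrite {2}AQ -row_mul !mulmxA mulmxV // mul1mx; apply/rowP => k.
rewrite !mxE (bigD1 i) //= !mxE eqxx mulr1n big1 ?addr0 // => l li.
by rewrite !mxE eq_sym (negPf li) mul0r.
Qed.
End RealSpectral.

(** * Taylor bounds for analytic functions *)

Lemma dist_exp_le (F : numDomainType) (x y rho : F) (k : nat) :
  `|x| <= rho -> `|y| <= rho ->
  `|x ^+ k.+1 - y ^+ k.+1| <= `|x - y| * (2 ^+ k.+1 * rho ^+ k).
Proof.
move=> xr yr; have rho0 : 0 <= rho := le_trans (normr_ge0 x) xr.
rewrite subrXX normrM; apply: ler_wpM2l => //.
apply: (@le_trans _ _ (\sum_(i < k.+1) rho ^+ k)).
  apply: (le_trans (ler_norm_sum _ _ _)); apply: ler_sum => i _ /=.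
  rewrite normrM !normrX.
  rewrite -[X in rho ^+ X](subnK (leq_ord i)).
  rewrite exprD; apply: ler_pM; rewrite ?exprn_ge0 //;
    by rewrite lerXn2r // nnegrE.
rewrite sumr_const card_ord -[leLHS]mulr_natl; apply: ler_wpM2r.
  by rewrite exprn_ge0.
by rewrite -natrX ler_nat ltnW // ltn_expl.
Qed.

Lemma sum_half_le (F : numFieldType) (n : nat) :
  \sum_(j < n) (2^-1 : F) ^+ j <= 2.
Proof.
suff -> : \sum_(j < n) (2^-1 : F) ^+ j = 2 - 2 * 2^-1 ^+ n.
  by rewrite gerBl mulr_ge0 // exprn_ge0 // invr_ge0.
elim: n => [|n IH]; first by rewrite big_ord0 expr0 mulr1 subrr.
by rewrite big_ord_recr /= IH exprS; field.
Qed.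

(** Bounding the increment of the second order Taylor remainder, rather than
    the remainder itself, makes the estimate usable for [f' (z + y)]: let [x]
    tend to [y]. *)
Definition second_order_bound (C : numFieldType) (f : C -> C)
    (z a1 a2 M s : C) : Prop :=
  forall x y rho : C, `|x| <= rho -> `|y| <= rho -> rho <= s ->
    `|(f (z + x) - f (z + y)) - (a1 * (x - y) + a2 * (x ^+ 2 - y ^+ 2))|
    <= M * `|x - y| * rho ^+ 2.

(** The terms [a k * q ^+ k] of the series at radius [q = r / 2] are bounded.
    For [rho <= q / 4] the increment of [a k * x ^+ k] is then at most a
    constant times [|x - y| rho^2 2^-k], because
    [|x^k - y^k| <= |x - y| k rho^(k-1)] and [k <= 2^k]; the bound passes to
    the limit of the partial sums. *)
Lemma analytic_second_order (C : numFieldType) (f : C -> C) (z : C) :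
  analytic_at f z ->
  exists a1 a2 M s : C,
    [/\ 0 < s, 0 <= M & second_order_bound f z a1 a2 M s].
Proof.
case=> a [r r0 fa].
pose q := r / 2.
have q0 : 0 < q by rewrite divr_gt0.
have qr : q < r by rewrite ltr_pdivrMr // ltr_pMr // ltr1n.
have [B B0 aB] : exists2 B : C, 0 < B & forall k, `|a k| * q ^+ k <= B.
  have cq : cvgn (series (fun k => a k * q ^+ k)).
    apply/cvg_ex; exists (f (z + q)).
    have := fa (z + q); rewrite (addrC z) addrK; apply.
    by rewrite gtr0_norm.
  have : bounded_fun (fun k => a k * q ^+ k).
    by apply: cvg_seq_bounded; apply/cvg_ex; exists 0; exact: cvg_series_cvg_0.
  move/ex_strict_bound_gt0 => [B B0 hB]; exists B => // k.
  have /= := hB k I; rewrite normrM normrX (gtr0_norm q0); exact: ltW.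
exists (a 1%N), (a 2%N), (16 * B / q ^+ 3), (q / 4).
split.
- by rewrite divr_gt0.
- by rewrite divr_ge0 ?mulr_ge0 ?exprn_ge0 ?ltW.
move=> x y rho xr yr rs.
have rho0 : 0 <= rho := le_trans (normr_ge0 x) xr.
have conv t : `|t| <= rho -> series (fun k => a k * t ^+ k) @ \oo --> f (z + t).
  move=> tr; have := fa (z + t); rewrite (addrC z) addrK; apply.
  apply: (le_lt_trans tr); apply: (le_lt_trans rs); apply: le_lt_trans qr.
  by rewrite ler_pdivrMr // ler_peMr ?ler1n ?ltW.
have cv := (cvgrPdist_lt _ _).1 (cvgB (conv x xr) (conv y yr)).
apply/ler_addgt0Pr => e e0.
(* The first three terms of the series are matched by the quadratic
   polynomial; [S] collects the others. *)
have [N _ hN] := cv _ _ e e0.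
have /= := hN (N + 3)%N (leq_addr _ _).
set D := f (z + x) - f (z + y).
rewrite !fctE /series /= -sumrB big_mkord.
under eq_bigr do rewrite -mulrBr.
rewrite addnC 3!big_ord_recl /= !expr0 subrr mulr0 add0r.
rewrite /bump /= !add1n !expr1.
set S := \sum_(i < N) _ => hD.
have SB : `|S| <= 16 * B / q ^+ 3 * `|x - y| * rho ^+ 2.
  apply: (@le_trans _ _
     (\sum_(j < N) 8 * B / q ^+ 3 * `|x - y| * rho ^+ 2 * 2^-1 ^+ j)).
    apply: (le_trans (ler_norm_sum _ _ _)); apply: ler_sum => j _ /=.
    rewrite normrM /bump /= !add1n.
    apply: (@le_trans _ _ (`|a j.+3| * (`|x - y| * (2 ^+ j.+3 * rho ^+ j.+2)))).
      by apply: ler_wpM2l => //; apply: dist_exp_le.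
    have -> : `|a j.+3| * (`|x - y| * (2 ^+ j.+3 * rho ^+ j.+2)) =
        `|a j.+3| * (`|x - y| * 8 * rho ^+ 2) * (2 * rho) ^+ j.
      rewrite exprMn !exprS; ring.
    have -> : 8 * B / q ^+ 3 * `|x - y| * rho ^+ 2 * 2^-1 ^+ j =
        B * ((`|x - y| * 8 * rho ^+ 2) * (q / 2) ^+ j) / (q ^+ j.+3).
      rewrite [(q / 2) ^+ j]exprMn -[j.+3]addn3 exprD.
      have qj0 : q ^+ j != 0 by rewrite expf_neq0 // gt_eqF.
      have qn0 : q != 0 by rewrite gt_eqF.
      by move: (q ^+ j) qj0 (2^-1 ^+ j) => qj qj0 hj; field; rewrite qj0 qn0.
    rewrite ler_pdivlMr ?exprn_gt0 // -[X in X * q ^+ _]mulrA mulrAC.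
    have E0 : 0 <= `|x - y| * 8 * rho ^+ 2 by rewrite !mulr_ge0 ?exprn_ge0.
    have rho2 : 2 * rho <= q / 2.
      have -> : q / 2 = 2 * (q / 4) by field.
      exact: ler_wpM2l.
    have r20 : 0 <= 2 * rho by rewrite mulr_ge0.
    apply: ler_pM => //.
    - by rewrite mulr_ge0 // exprn_ge0 // ltW.
    - by rewrite mulr_ge0 // exprn_ge0.
    - by apply: ler_wpM2l => //; rewrite lerXn2r // nnegrE // (le_trans r20).
  rewrite -mulr_sumr.
  have -> : 16 * B / q ^+ 3 * `|x - y| * rho ^+ 2 =
     8 * B / q ^+ 3 * `|x - y| * rho ^+ 2 * 2 by ring.
  apply: ler_wpM2l; last exact: sum_half_le.
  by rewrite !mulr_ge0 ?invr_ge0 ?exprn_ge0 // ltW.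
have -> : D - (a 1%N * (x - y) + a 2%N * (x ^+ 2 - y ^+ 2)) =
   D - (a 1%N * (x - y) + (a 2%N * (x ^+ 2 - y ^+ 2) + S)) + S by ring.
apply: (le_trans (ler_normD _ _)); rewrite addrC lerD // ltW //.
Qed.

Lemma cvg_dnbhs0_lipschitz (C : numFieldType) (F : C -> C) (l M s : C) :
  0 < s -> 0 <= M ->
  (forall h, h != 0 -> `|h| <= s -> `|l - F h| <= M * `|h|) ->
  F h @[h --> 0^'] --> l.
Proof.
move=> s0 M0 hF; apply/cvgrPdist_lt => e e0.
have eM : 0 < e / (M + 1) by rewrite divr_gt0 // ltr_wpDl.
near=> h.
have hs : `|h| <= s by near: h; exact: dnbhs0_le.
have he : `|h| < e / (M + 1) by near: h; exact: dnbhs0_lt.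
have h0 : h != 0 by near: h; exact: nbhs_dnbhs_neq.
apply: (le_lt_trans (hF h h0 hs)).
apply: (@le_lt_trans _ _ ((M + 1) * `|h|)); first by rewrite ler_wpM2r // lerDl.
by rewrite mulrC -ltr_pdivlMr // ltr_wpDl.
Unshelve. all: by end_near. Qed.

Lemma derive1_of_taylor1 (C : numFieldType) (f : C -> C) (z a M s : C) :
  0 < s -> 0 <= M ->
  (forall x, `|x| <= s -> `|f (z + x) - f z - a * x| <= M * `|x| ^+ 2) ->
  derive1 f z = a.
Proof.
move=> s0 M0 hf; apply: cvg_lim; first exact: norm_hausdorff.
apply: (cvg_dnbhs0_lipschitz s0 M0) => h h0 hs.
have -> : a - h^-1 *: (f (h + z) - f z) = - (f (z + h) - f z - a * h) / h.
  by rewrite [_ *: _]mulrC (addrC h); field.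
rewrite normrM normrN normfV ler_pdivrMr ?normr_gt0 // -mulrA -expr2.
exact: hf.
Qed.

Lemma exists_pos_le2 (F : numFieldType) (p q : F) : 0 < p -> 0 < q ->
  exists2 t, 0 < t & t <= p /\ t <= q.
Proof.
move=> p0 q0; have pq : 0 < p + q by rewrite addr_gt0.
exists (p * q / (p + q)); first by rewrite divr_gt0 ?mulr_gt0.
split; rewrite ler_pdivrMr //.
  by apply: ler_wpM2l; [exact: ltW | rewrite lerDr ltW].
by rewrite mulrC; apply: ler_wpM2l; [exact: ltW | rewrite lerDl ltW].
Qed.

Lemma second_order_taylor1 (C : numFieldType) (f : C -> C)
    (z a1 a2 M s : C) :
  0 < s -> 0 <= M -> second_order_bound f z a1 a2 M s ->
  forall x, `|x| <= s ->
    `|f (z + x) - f z - a1 * x| <= (M * s + `|a2|) * `|x| ^+ 2.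
Proof.
move=> s0 M0 hf x xs.
have := hf x 0 `|x| (lexx _); rewrite normr0 => /(_ (normr_ge0 _) xs).
rewrite addr0 subr0 expr0n /= subr0 => hx.
have -> : f (z + x) - f z - a1 * x =
  f (z + x) - f z - (a1 * x + a2 * x ^+ 2) + a2 * x ^+ 2 by ring.
apply: (le_trans (ler_normD _ _)); rewrite normrM normrX mulrDl lerD //.
apply: (le_trans hx); apply: ler_wpM2r; first exact: exprn_ge0.
exact: ler_wpM2l.
Qed.

Lemma second_order_derive1 (C : numFieldType) (f : C -> C)
    (z a1 a2 M s : C) :
  0 < s -> 0 <= M -> second_order_bound f z a1 a2 M s -> derive1 f z = a1.
Proof.
move=> s0 M0 hf.
apply: (derive1_of_taylor1 (s := s) (M := M * s + `|a2|)) => //.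
  by rewrite addr_ge0 // mulr_ge0 // ltW.
exact: second_order_taylor1.
Qed.

Lemma analytic_taylor1 (C : numFieldType) (f : C -> C) (z : C) :
  analytic_at f z -> exists M s : C, [/\ 0 < s, 0 <= M &
    forall x, `|x| <= s ->
      `|f (z + x) - f z - derive1 f z * x| <= M * `|x| ^+ 2].
Proof.
case/analytic_second_order => a1 [a2 [M [s [s0 M0 hf]]]].
rewrite (second_order_derive1 s0 M0 hf); exists (M * s + `|a2|), s; split => //.
  by rewrite addr_ge0 // mulr_ge0 // ltW.
exact: second_order_taylor1.
Qed.

(** Near [z + y] the function has its own first order expansion, of slope
    [f' (z + y)]; comparing it with the expansion at [z] for an increment
    [h] and letting [h] tend to 0 gives the estimate. *)
Lemma derive1_taylor1 (C : numFieldType) (f : C -> C) (z a1 a2 M s : C) :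
  0 < s -> 0 <= M -> second_order_bound f z a1 a2 M s ->
  forall y, `|y| <= s / 2 -> y != 0 -> analytic_at f (z + y) ->
    `|derive1 f (z + y) - a1 - 2 * a2 * y| <= 4 * M * `|y| ^+ 2.
Proof.
move=> s0 M0 hf y ys y0 /analytic_taylor1[N [t [t0 N0 hw]]].
set b := derive1 f (z + y) in hw *.
have ny : 0 < `|y| by rewrite normr_gt0.
apply/ler_addgt0Pr => e e0.
pose k := `|a2| + N + 1.
have k0 : 0 < k by rewrite ltr_wpDl // addr_ge0.
have [u u0 [ut uy]] := exists_pos_le2 t0 ny.
have [h h0 [hu he]] := exists_pos_le2 u0 (divr_gt0 e0 k0).
have nh : `|h| = h by rewrite gtr0_norm.
have ht : `|h| <= t by rewrite nh (le_trans hu).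
have hy : `|h| <= `|y| by rewrite nh (le_trans hu).
have := hw h ht; rewrite -(addrA z y h) => h1.
have y2 : 2 * `|y| = `|y| + `|y| by rewrite mulr_natl mulr2n.
have h2 : `|f (z + (y + h)) - f (z + y) - (a1 * h + a2 * (h * (2 * y + h)))|
    <= M * `|h| * (2 * `|y|) ^+ 2.
  have := hf (y + h) y (2 * `|y|); rewrite (addrAC y) subrr add0r.
  have -> : (y + h) ^+ 2 - y ^+ 2 = h * (2 * y + h) by ring.
  apply.
  - by rewrite y2 (le_trans (ler_normD _ _)) // lerD2l.
  - by rewrite y2 lerDl.
  - by rewrite mulrC -ler_pdivlMr.
rewrite -(ler_pM2r h0) -{1}nh -normrM.
have -> : (b - a1 - 2 * a2 * y) * h =
  (f (z + (y + h)) - f (z + y) - (a1 * h + a2 * (h * (2 * y + h))))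
  - (f (z + (y + h)) - f (z + y) - b * h) + a2 * h * h by ring.
apply: (le_trans (ler_normD _ _)).
apply: (@le_trans _ _
  (M * `|h| * (2 * `|y|) ^+ 2 + N * `|h| ^+ 2 + `|a2| * h * h)).
  apply: lerD; last by rewrite !normrM nh.
  by apply: (le_trans (ler_normB _ _)); exact: lerD.
rewrite nh.
have -> : M * h * (2 * `|y|) ^+ 2 + N * h ^+ 2 + `|a2| * h * h =
  (4 * M * `|y| ^+ 2 + (`|a2| + N) * h) * h by ring.
rewrite ler_pM2r // lerD2l (le_trans (_ : _ <= k * h)) //.
  by apply: ler_wpM2r; [exact: ltW | rewrite lerDl].
by rewrite mulrC -ler_pdivlMr.
Qed.

(** [f' (z + y)] is [f' z + 2 a2 y] up to second order in [y], so the second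
    derivative at [z] is twice the quadratic coefficient [a2]. *)
Lemma analytic_taylor2 (C : numFieldType) (f : C -> C) (z : C) :
  (\forall w \near z, analytic_at f w) ->
  exists M s : C, [/\ 0 < s, 0 <= M & forall x, `|x| <= s ->
    `|f (z + x) - f z - derive1 f z * x - derive1n 2 f z / 2 * x ^+ 2|
    <= M * `|x| ^+ 3].
Proof.
move=> fz; have /analytic_second_order := nbhs_singleton fz.
case=> a1 [a2 [M [s [s0 M0 hf]]]].
have f1 := second_order_derive1 s0 M0 hf.
have [e e0 he] := (nbhs_normP _ _).1 fz.
have s2 : 0 < s / 2 by rewrite divr_gt0.
have [u u0 [us ue]] := exists_pos_le2 s2 (divr_gt0 e0 (ltr0Sn _ 1)).
have f2 : derive1n 2 f z = 2 * a2.
  apply: (derive1_of_taylor1 u0 (M := 4 * M)); first by rewrite mulr_ge0.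
  move=> x xu; have [->|x0] := eqVneq x 0.
    by rewrite addr0 subrr mulr0 subr0 normr0 expr0n mulr0.
  rewrite /= f1; apply: (derive1_taylor1 s0 M0 hf) => //.
    exact: le_trans us.
  apply: he; rewrite /ball_ /= opprD addrA subrr sub0r normrN.
  apply: (le_lt_trans xu); apply: (le_lt_trans ue).
  by rewrite ltr_pdivrMr // ltr_pMr // ltr1n.
exists M, s; split => // x xs; rewrite f1 f2.
have := hf x 0 `|x| (lexx _); rewrite normr0 => /(_ (normr_ge0 _) xs).
rewrite addr0 subr0 expr0n /= subr0 -mulrA -exprS.
have -> : 2 * a2 / 2 = a2 by field.
by rewrite opprD addrA.
Qed.

Lemma lipschitz_at_continuous (C : numFieldType) (F : C -> C) (z M s : C) :
  0 < s -> 0 <= M ->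
  (forall x, x != 0 -> `|x| <= s -> `|F z - F (z + x)| <= M * `|x|) ->
  {for z, continuous F}.
Proof.
move=> s0 M0 hF; rewrite /prop_for /continuous_at.
apply: ((@cvgrPdist_lt C C C (nbhs z) (nbhs_filter z) F (F z)).2) => e e0.
have eM : 0 < e / (M + 1) by rewrite divr_gt0 // ltr_wpDl.
have [u u0 [us ue]] := exists_pos_le2 s0 eM.
apply/nbhs_normP; exists u => // w; rewrite /ball_ /= distrC => wu.
have [->|wz] := eqVneq w z; first by rewrite subrr normr0.
have -> : w = z + (w - z) by rewrite addrC subrK.
apply: le_lt_trans (hF _ _ _) _; first by rewrite subr_eq0.
  by rewrite (le_trans (ltW wu)).
apply: (@le_lt_trans _ _ ((M + 1) * `|w - z|)).
  by apply: ler_wpM2r; rewrite ?lerDl.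
rewrite mulrC -ltr_pdivlMr ?ltr_wpDl //; exact: lt_le_trans ue.
Qed.

Lemma analytic_continuous (C : numFieldType) (f : C -> C) (z : C) :
  analytic_at f z -> {for z, continuous f}.
Proof.
case/analytic_taylor1 => M [s [s0 M0 hf]].
apply: (lipschitz_at_continuous s0 (M := M * s + `|derive1 f z|)).
  by rewrite addr_ge0 // mulr_ge0 // ltW.
move=> x _ xs; rewrite distrC -[f (z + x) - f z](subrK (derive1 f z * x)).
apply: (le_trans (ler_normD _ _)); rewrite normrM mulrDl lerD //.
apply: (le_trans (hf x xs)); rewrite expr2 mulrA; apply: ler_wpM2r => //.
exact: ler_wpM2l.
Qed.

(** Away from [theta j] the term is a rational expression in [f]; at
    [theta j] the Taylor bound shows that it differs from its value there by at
    most a constant times the increment. *)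
Lemma gm_term_continuous (C : numFieldType) (f : C -> C) (m : nat)
    (alpha beta theta : 'I_m -> C) (j : 'I_m) (z : C) :
  (\forall w \near theta j, analytic_at f w) -> analytic_at f z ->
  {for z, continuous (gm_term f alpha beta theta j)}.
Proof.
move=> ft fz; set ab := alpha j ^+ 2 * beta j ^+ 2.
pose k := 2 * (alpha j * beta j) * gamma_coef alpha beta theta j.
have [zt|zt] := eqVneq z (theta j); last first.
  pose G z := ab * ((f z - f (theta j)) / (z - theta j) ^+ 2
      - derive1 f (theta j) / (z - theta j))
    + k * ((f z - f (theta j)) / (z - theta j)).
  have zt0 : z - theta j != 0 by rewrite subr_eq0.
  have : {for z, continuous G}.
    have cf : f w @[w --> z] --> f z := analytic_continuous fz.
    have cfB : f w - f (theta j) @[w --> z] --> f z - f (theta j).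
      exact: (cvgB cf (cvg_cst _)).
    have cB : w - theta j @[w --> z] --> z - theta j.
      exact: (cvgB cvg_id (cvg_cst _)).
    have cV : (w - theta j)^-1 @[w --> z] --> (z - theta j)^-1.
      exact: (cvgV zt0 cB).
    have cV2 : ((w - theta j) ^+ 2)^-1 @[w --> z] --> ((z - theta j) ^+ 2)^-1.
      exact: (cvgV (mulf_neq0 zt0 zt0) (cvgM cB cB)).
    exact: (cvgD (cvgM (cvg_cst ab)
      (cvgB (cvgM cfB cV2) (cvgM (cvg_cst _) cV)))
      (cvgM (cvg_cst k) (cvgM cfB cV))).
  move=> cG; rewrite /prop_for /continuous_at.
  have -> : gm_term f alpha beta theta j z = G z by rewrite /gm_term zt.
  apply: cvg_trans cG; apply: (@near_eq_cvg _ _ (nbhs z) (nbhs_filter z)).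
  have : \forall w \near z, w != theta j.
    apply/nbhs_normP; exists `|z - theta j|; first by rewrite /= normr_gt0.
    by move=> w /=; apply: contraTneq => ->; rewrite ltxx.
  move/(@filterS _ (nbhs z) (nbhs_filter z) (fun w => w != theta j)).
  by apply=> w wt; rewrite /gm_term wt.
have [M [s [s0 M0 hf]]] := analytic_taylor2 ft.
rewrite zt; set t := theta j in hf *.
set d1 := derive1 f t in hf *; set d2 := derive1n 2 f t in hf *.
apply: (lipschitz_at_continuous s0
    (M := `|ab| * M + `|k| * (`|d2 / 2| + M * s))).
  by rewrite !addr_ge0 ?mulr_ge0 ?addr_ge0 ?mulr_ge0 // ltW.
move=> x x0 xs; rewrite distrC.
have nx : 0 < `|x| by rewrite normr_gt0.
(* The Taylor remainder divided by [x ^+ 2], which is of order [x]. *)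
pose T := (f (t + x) - f t - d1 * x - d2 / 2 * x ^+ 2) / x ^+ 2.
have hT : `|T| <= M * `|x|.
  rewrite normrM normfV normrX ler_pdivrMr ?exprn_gt0 // -[leRHS]mulrA -exprS.
  exact: hf.
have -> : gm_term f alpha beta theta j (t + x) -
    gm_term f alpha beta theta j t = ab * T + k * (d2 / 2 * x + T * x).
  rewrite /gm_term -/t -/d1 -/d2 eqxx /= -subr_eq0 addrAC subrr add0r x0.
  by rewrite /ab /k /T; field.
clearbody ab k T; apply: (le_trans (ler_normD _ _)).
rewrite mulrDl (normrM ab) (normrM k) lerD //.
  by rewrite -mulrA ler_wpM2l.
rewrite -[leRHS]mulrA ler_wpM2l // (le_trans (ler_normD _ _)) //.
rewrite mulrDl (normrM _ x).
rewrite lerD // (normrM T) ler_wpM2r // (le_trans hT) // ler_wpM2l //.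
Qed.

Lemma gm_continuous_at (C : numFieldType) (f : C -> C) (m : nat)
    (alpha beta theta : 'I_m -> C) (z : C) :
  (forall j, \forall w \near theta j, analytic_at f w) -> analytic_at f z ->
  {for z, continuous (gm f alpha beta theta)}.
Proof.
move=> ft fz.
pose addC := @pseudometric_normed_Zmodule.add_continuous C C.
apply: (@cvg_big C 'I_m +%R 0 xpredT addC C (nbhs z) (index_enum _)
  (gm_term f alpha beta theta) (gm_term f alpha beta theta ^~ z)
  (nbhs_filter z)) => j _.
exact: gm_term_continuous.
Qed.

Local Open Scope complex_scope.

(** * The error function on a real interval *)

Lemma normr_real_complex (R : rcfType) (x : R) : `|x%:C| = `|x|%:C.
Proof. by rewrite normc_def /= expr0n /= addr0 sqrtr_sqr. Qed.

Lemma normr_Re_le (R : rcfType) (z : R[i]) : `|complex.Re z|%:C <= `|z|.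
Proof.
rewrite normc_def lecR -sqrtr_sqr ler_sqrt; first by rewrite lerDl sqr_ge0.
by rewrite addr_ge0 // sqr_ge0.
Qed.

Lemma normr_Im_le (R : rcfType) (z : R[i]) : `|complex.Im z|%:C <= `|z|.
Proof.
rewrite normc_def lecR -sqrtr_sqr ler_sqrt; first by rewrite lerDr sqr_ge0.
by rewrite addr_ge0 // sqr_ge0.
Qed.

Lemma gt0_complexP (R : rcfType) (u : R[i]) : 0 < u ->
  exists2 r : R, 0 < r & u = r%:C.
Proof.
move=> u0; have /complex_realP[r ur] : u \is Num.real by exact: gtr0_real.
by exists r => //; move: u0; rewrite ur ltcR.
Qed.

Lemma real_half (F : numFieldType) (x : F) :
  x / 2 \is Num.real -> x \is Num.real.
Proof. by move=> x2; rewrite -[x](@divfK _ 2) // rpredM // realn. Qed.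

(** The imaginary part of [l] is bounded by its distance to any real number. *)
Lemma real_of_real_approx (R : realType) (l : R[i]) (M : R[i]) :
  0 <= M ->
  (forall d : R, 0 < d -> exists2 q : R[i], q \is Num.real &
     `|q - l| <= M * d%:C) -> l \is Num.real.
Proof.
move=> M0 hl; have /complex_realP[N MN] : M \is Num.real by exact: ger0_real.
have N0 : 0 <= N by move: M0; rewrite MN lecR.
suff i0 : complex.Im l = 0.
  by case: l {hl} i0 => a b /= ->; rewrite complex_real.
apply/eqP; rewrite -normr_le0; apply/ler_addgt0Pr => e e0; rewrite add0r.
have N1 : 0 < N + 1 by rewrite ltr_wpDl.
have [q /complex_realP[k ->]] := hl _ (divr_gt0 e0 N1).
rewrite distrC => /(le_trans (normr_Im_le _)).
rewrite MN -rmorphM /= lecR; case: l {hl} => a b /=; rewrite oppr0 addr0.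
move/le_trans; apply; rewrite mulrCA ger_pMr //.
by rewrite ler_pdivrMr // mul1r lerDl.
Qed.

(** At the endpoint [b] one has to move to the left, which is why the interval
    must be nondegenerate. *)
Lemma interval_nearby (R : realFieldType) (a b t d : R) :
  a < b -> a <= t <= b -> 0 < d ->
  exists2 h, h != 0 /\ `|h| <= d & a <= t + h <= b.
Proof.
move=> ab /andP[at_ tb] d0; have [tltb|] := ltP t b.
  have h0 : 0 < Num.min d (b - t) by rewrite lt_min d0 subr_gt0.
  exists (Num.min d (b - t)).
    by rewrite gt_eqF // gtr0_norm // ge_min lexx.
  have hb : Num.min d (b - t) <= b - t by rewrite ge_min lexx orbT.
  by apply/andP; split; lra.
move=> bt; have h0 : 0 < Num.min d (t - a).
  by rewrite lt_min d0 subr_gt0 (lt_le_trans ab).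
exists (- Num.min d (t - a)).
  by rewrite oppr_eq0 gt_eqF // normrN gtr0_norm // ge_min lexx.
have hb : Num.min d (t - a) <= t - a by rewrite ge_min lexx orbT.
by apply/andP; split; lra.
Qed.

Lemma gm_term_real (C : numFieldType) (f : C -> C) (m : nat)
    (alpha beta theta : 'I_m -> C) (j : 'I_m) (z : C) :
  (forall l, alpha l \is Num.real) -> (forall l, beta l \is Num.real) ->
  (forall l, theta l \is Num.real) -> z \is Num.real -> f z \is Num.real ->
  f (theta j) \is Num.real -> derive1 f (theta j) \is Num.real ->
  derive1n 2 f (theta j) \is Num.real ->
  gm_term f alpha beta theta j z \is Num.real.
Proof.
move=> ra rb rt rz rfz rft r1 r2.
have rgam : gamma_coef alpha beta theta j \is Num.real.
  by apply: rpred_sum => l _; rewrite rpredM ?rpredV ?rpredB ?rpredM.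
rewrite /gm_term; move: rgam r1 r2.
move: (gamma_coef _ _ _ _) (derive1 f _) (derive1n 2 f _) => gam d1 d2 *.
case: ifP => _;
  repeat first [done | exact: realn | rewrite rpredV | apply: rpredB
    | apply: rpredX | apply: rpredM | apply: rpredD].
Qed.

Section RealOnInterval.
Variables (R : realType) (a b : R) (f : R[i] -> R[i]).
Local Notation C := (R[i] : numFieldType).
Hypothesis ab : a < b.
Hypothesis hf : analytic_around [set x%:C | x in `[a, b]] f.
Hypothesis fR : forall x : R, a <= x <= b -> f x%:C \is Num.real.

Lemma analytic_near_interval (x : R) : a <= x <= b ->
  \forall w \near (x%:C : C), analytic_at (f : C -> C) w.
Proof.
move=> xab; have [U [oU SU hU]] := hf.
have Ux : nbhs (x%:C : C) U.
  by apply: open_nbhs_nbhs; split => //; apply: SU; exists x.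
exact: filterS hU Ux.
Qed.

(** [f] is only known to be real on the interval, so the derivative is
    approximated by difference quotients along points of the interval. *)
Lemma derive1_real (t : R) :
  a <= t <= b -> derive1 (f : C -> C) t%:C \is Num.real.
Proof.
move=> tab.
have [M [s [s0 M0 hT]]] :=
  analytic_taylor1 (nbhs_singleton (analytic_near_interval tab)).
have [r r0 sr] := gt0_complexP s0; rewrite sr in hT.
apply: (real_of_real_approx M0) => d d0.
have rd : 0 < Num.min r d by rewrite lt_min r0.
have [h [h0]] := interval_nearby ab tab rd.
rewrite le_min => /andP[hr hd] th.
have hC : h%:C != 0 by apply: contra h0 => /eqP[->].
exists ((f (t + h)%:C - f t%:C) / h%:C).
  by rewrite rpredM ?rpredB ?fR // rpredV; apply/complex_realP; exists h.
have := hT h%:C; rewrite normr_real_complex lecR => /(_ hr) le1.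
have -> : (f (t + h)%:C - f t%:C) / h%:C - derive1 (f : C -> C) t%:C =
   (f (t%:C + h%:C) - f t%:C - derive1 (f : C -> C) t%:C * h%:C) / h%:C.
  by rewrite rmorphD /=; field.
rewrite normrM normfV ler_pdivrMr ?normr_gt0 // normr_real_complex.
apply: (le_trans le1); rewrite expr2 mulrA; apply: ler_wpM2r.
  by rewrite lecR.
by apply: ler_wpM2l => //; rewrite lecR.
Qed.

Lemma derive2_real (t : R) :
  a <= t <= b -> derive1n 2 (f : C -> C) t%:C \is Num.real.
Proof.
move=> tab.
have [M [s [s0 M0 hT]]] := analytic_taylor2 (analytic_near_interval tab).
have [r r0 sr] := gt0_complexP s0; rewrite sr in hT.
apply: real_half.
apply: (real_of_real_approx M0) => d d0.
have rd : 0 < Num.min r d by rewrite lt_min r0.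
have [h [h0]] := interval_nearby ab tab rd.
rewrite le_min => /andP[hr hd] th.
have hC : h%:C != 0 by apply: contra h0 => /eqP[->].
have hR : h%:C \is Num.real by apply/complex_realP; exists h.
exists ((f (t + h)%:C - f t%:C - derive1 (f : C -> C) t%:C * h%:C) / h%:C ^+ 2).
  rewrite rpredM ?rpredB ?fR // ?rpredV ?rpredX //.
  by rewrite rpredM // derive1_real.
have := hT h%:C; rewrite normr_real_complex lecR => /(_ hr) le1.
set d1 := derive1 (f : C -> C) t%:C in le1 *.
set d2 := derive1n 2 (f : C -> C) t%:C in le1 *.
have -> : (f (t + h)%:C - f t%:C - d1 * h%:C) / h%:C ^+ 2 - d2 / 2 =
    (f (t%:C + h%:C) - f t%:C - d1 * h%:C - d2 / 2 * h%:C ^+ 2) / h%:C ^+ 2.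
  by rewrite rmorphD /=; field.
rewrite normrM normfV normrX ler_pdivrMr ?exprn_gt0 ?normr_gt0 //.
rewrite normr_real_complex.
apply: (le_trans le1); rewrite [_ ^+ 3]exprS mulrA; apply: ler_wpM2r.
  by rewrite exprn_ge0 // lecR.
by apply: ler_wpM2l => //; rewrite lecR.
Qed.

Section ErrorFunctionOnInterval.
Variables (m : nat) (alpha beta theta : 'I_m -> R).
Hypothesis htheta : forall j, a <= theta j <= b.
Local Notation g := (gm f (fun j => (alpha j)%:C) (fun j => (beta j)%:C)
  (fun j => (theta j)%:C)).

Lemma gm_real (x : R) : a <= x <= b -> g x%:C \is Num.real.
Proof.
move=> xab.
have RC (y : R) : y%:C \is Num.real by apply/complex_realP; exists y.
apply: rpred_sum => j _; apply: gm_term_real => //; try exact: fR.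
  exact: derive1_real.
exact: derive2_real.
Qed.

Lemma gm_continuous (x : R) :
  a <= x <= b -> {for (x%:C : C), continuous (g : C -> C)}.
Proof.
move=> xab; apply: gm_continuous_at => [j|].
  exact: analytic_near_interval.
exact: (nbhs_singleton (analytic_near_interval xab)).
Qed.

Lemma Re_gm_continuous :
  {within `[a, b], continuous (fun x : R => complex.Re (g x%:C))}.
Proof.
apply: continuous_in_subspaceT => x; rewrite inE /= in_itv /= => xab.
have gx := gm_continuous xab.
apply/cvgrPdist_lt => e e0.
have e0C : 0 < e%:C by rewrite ltcR.
have /nbhs_normP[u u0 hu] :=
  (@cvgrPdist_lt _ _ _ _ (nbhs_filter _) _ _).1 gx _ e0C.
have [r r0 ur] := gt0_complexP u0.
apply/nbhs_normP; exists r => // y /= xy.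
have := hu y%:C; rewrite /ball_ /= ur -rmorphB normr_real_complex ltcR.
move/(_ xy).
move/(le_lt_trans (normr_Re_le _)); rewrite ltcR.
by rewrite raddfB.
Qed.
End ErrorFunctionOnInterval.
End RealOnInterval.

(** The mean lies between the extreme values of [G] on the interval; apply the
    intermediate value theorem between a minimizer and a maximizer. *)
Lemma continuous_weighted_mean (R : realType) (a b : R) (G : R -> R) (n : nat)
    (w l : 'I_n -> R) :
  a <= b -> {within `[a, b], continuous G} ->
  (forall i, 0 <= w i) -> \sum_i w i = 1 -> (forall i, a <= l i <= b) ->
  exists2 z, a <= z <= b & G z = \sum_i w i * G (l i).
Proof.
move=> ab cG w0 w1 lab; set v := \sum_i _.
have [p pab pmin] := EVT_min ab cG; have [q qab qmax] := EVT_max ab cG.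
have pv : G p <= v.
  rewrite -[G p]mul1r -w1 mulr_suml; apply: ler_sum => i _.
  by apply: ler_wpM2l => //; apply: pmin; rewrite in_itv /= lab.
have vq : v <= G q.
  rewrite -[G q]mul1r -w1 mulr_suml; apply: ler_sum => i _.
  by apply: ler_wpM2l => //; apply: qmax; rewrite in_itv /= lab.
have sub c d : c \in `[a, b] -> d \in `[a, b] ->
    {within `[c, d], continuous G}.
  rewrite !in_itv /= => /andP[ac _] /andP[_ db].
  apply: continuous_subspaceW cG => x /=; rewrite !in_itv /= => /andP[cx xd].
  by rewrite (le_trans ac) // (le_trans xd).
have inab c d x :
    c \in `[a, b] -> d \in `[a, b] -> x \in `[c, d] -> a <= x <= b.
  rewrite !in_itv /= => /andP[ac _] /andP[_ db] /andP[cx xd].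
  by rewrite (le_trans ac) // (le_trans xd).
have [pq|/ltW qp] := leP p q.
  have [|z zI zv] := IVT (v := v) pq (sub _ _ pab qab).
    by rewrite ge_min pv le_max vq orbT.
  by exists z => //; exact: inab zI.
have [|z zI zv] := IVT (v := v) qp (sub _ _ qab pab).
  by rewrite ge_min pv orbT le_max vq.
by exists z => //; exact: inab zI.
Qed.

(** * Ritz values and the error formula *)

Lemma mxfun_quadZ (R : realType) (f : R[i] -> R[i]) (n : nat) (A : 'M[R]_n)
    (k : R) (v : 'cV[R]_n) :
  mxfun_quad f A (k *: v) = (k ^+ 2)%:C * mxfun_quad f A v.
Proof.
rewrite /mxfun_quad /= map_mxZ -scalemxAr.
have -> : (k%:C *: toC v)^T = k%:C *: (toC v)^T.
  by apply/matrixP => i j; rewrite !mxE.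
rewrite -!scalemxAl.
by rewrite scalerA mxE -rmorphM -expr2.
Qed.

Section RationalArnoldi.
Variables (R : realType) (n m : nat) (A : 'M[R]_n.+1) (b : 'cV[R]_n.+1).
Variables (xi : 'I_m -> option R) (V : 'M[R]_(n.+1, m + 1)).
Variables (K H : 'M[R]_(m + 1, m)) (U : 'M[R]_m) (theta : 'rV[R]_m).
Hypothesis m_gt0 : (0 < m)%N.
Hypothesis hA : A \is symmetricmx.
Hypothesis hxi : forall (i : 'I_m) (x : R), xi i = Some x ->
  x != 0 /\ ~~ eigenvalue A x.
Hypothesis hrad : rat_arnoldi_decomp A b xi V K H.
Local Notation Vm := (lsubmx V).
Local Notation Am := (Vm^T *m A *m Vm).
Hypothesis hU : U^T *m U = 1%:M.
Hypothesis hAm : Am = U *m diag_mx theta *m U^T.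
Local Notation alpha := (dsubmx H *m invmx (usubmx K) *m U).
Local Notation beta := (U^T *m e1 R m).

Lemma ritz_residual :
  A *m (Vm *m U) = Vm *m U *m diag_mx theta + rsubmx V *m alpha.
Proof.
rewrite mulmxA (rad_mul_basis hrad) hAm mulmxDl -!mulmxA hU mulmx1.
by rewrite !mulmxA.
Qed.

Lemma ritz_orthonormal : (Vm *m U)^T *m (Vm *m U) = 1%:M.
Proof.
have [VV _ _ _] := rad_orthonormal_blocks hrad.
by rewrite trmx_mul -mulmxA (mulmxA _ Vm) VV mul1mx hU.
Qed.

(** A vector [y] with [alpha y = 0] in an eigenspace of the projected matrix
    is lifted by [Vm *m U] to an eigenvector of [A], which cannot exist. *)
Lemma ritz_no_eigenvector (t : R) (y : 'cV[R]_m) :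
  diag_mx theta *m y = t *: y -> alpha *m y = 0 -> y = 0.
Proof.
move=> ty ay.
have : Vm *m (U *m y) = 0.
  apply: (krylov_no_eigenvector (t := t) hxi (rad_orthonormal hrad)
           (rad_col_krylov hrad) (rad_range_krylov _ m_gt0 hrad)).
  rewrite !mulmxA -(mulmxA A) ritz_residual mulmxDl.
  rewrite -[rsubmx V *m _ *m y]mulmxA ay mulmx0 addr0.
  by rewrite -(mulmxA _ (diag_mx theta)) ty -scalemxAr.
move/(congr1 (mulmx (Vm *m U)^T)); rewrite mulmx0 (mulmxA Vm) mulmxA.
by rewrite ritz_orthonormal mul1mx.
Qed.

Lemma alpha_neq0 (j : 'I_m) : alpha 0 j != 0.
Proof.
apply/eqP => aj0.
have : delta_mx j (0 : 'I_1) = 0 :> 'cV[R]_m.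
  apply: (ritz_no_eigenvector (t := theta 0 j)).
    apply/colP => k; rewrite mul_diag_mx !mxE.
    by case: eqVneq => [->|]; rewrite ?mulr0.
  by apply/colP => k; rewrite -colE !ord1 mxE aj0 mxE.
by move/colP/(_ j); rewrite !mxE !eqxx => /eqP; rewrite oner_eq0.
Qed.

(** If two Ritz values coincided, a combination of the two Ritz vectors with
    coefficients [alpha_k] and [- alpha_j] would have zero residual. *)
Lemma theta_inj : injective (theta 0).
Proof.
move=> j k tjk; apply/eqP; apply: contraT => jk.
pose y : 'cV[R]_m := alpha 0 k *: delta_mx j 0 - alpha 0 j *: delta_mx k 0.
have : y = 0.
  apply: (ritz_no_eigenvector (t := theta 0 j)).
    apply/colP => l; rewrite mul_diag_mx [LHS]mxE [RHS]mxE.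
    rewrite /y !mxE; have [->|lj] := eqVneq l j; first by [].
    have [->|lk] := eqVneq l k; first by rewrite tjk.
    by rewrite !mulr0 subrr !mulr0.
  rewrite /y mulmxBr -!scalemxAr -!colE; apply/colP => l.
  by move: (alpha) => al; rewrite !ord1 !mxE mulrC subrr.
move/colP/(_ j); have := alpha_neq0 k; rewrite /y.
move: (alpha) => al ak; rewrite !mxE !eqxx (negPf jk) mulr1 mulr0 subr0.
by move/eqP; rewrite (negPf ak).
Qed.

Variables (P : 'M[R[i]]_n.+1) (l : 'I_n.+1 -> R).
Hypothesis uP : P \is unitarymx.
Hypothesis PE : toC A = P ^t* *m diag_mx (\row_i (l i)%:C) *m P.
Local Notation Y := (Vm *m U).
Local Notation d i := ((P *m toC (rsubmx V)) i 0).
Local Notation y i j := ((P *m toC (col j Y)) i 0).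

Lemma ritz_residual_coord (i : 'I_n.+1) (j : 'I_m) :
  ((l i)%:C - (theta 0 j)%:C) * y i j = d i * (alpha 0 j)%:C.
Proof.
have res : A *m col j Y = theta 0 j *: col j Y + alpha 0 j *: rsubmx V.
  have -> : A *m col j Y = col j (A *m Y) by rewrite !colE mulmxA.
  rewrite ritz_residual raddfD /=; congr (_ + _).
    by move: Y => W; apply/colP => k; rewrite mul_mx_diag !mxE mulrC.
  move: (alpha) (rsubmx V) => al v; apply/colP => k.
  by rewrite !mxE big_ord1 mulrC.
have PA : P *m toC A = diag_mx (\row_i (l i)%:C) *m P.
  have PP : P *m P ^t* = 1%:M by apply/unitarymxP.
  by rewrite PE !mulmxA PP mul1mx.
have /colP/(_ i) := congr1 (fun w => P *m toC w) res.
rewrite map_mxM mulmxA PA -mulmxA map_mxD !map_mxZ mulmxDr -!scalemxAr.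
move: (P *m toC (col j Y)) (P *m toC (rsubmx V)) (alpha 0 j) => p q a.
by rewrite mul_diag_mx !mxE mulrBl => ->; rewrite addrAC subrr add0r mulrC.
Qed.

Lemma residual_coord_dot (j : 'I_m) : \sum_i y i j * (d i)^*%R = 0.
Proof.
have [_ _ vV _] := rad_orthonormal_blocks hrad.
by rewrite unitary_dot // colE !mulmxA vV !mul0mx mxE rmorph0.
Qed.

Lemma residual_coord_dotC (j : 'I_m) : \sum_i d i * (y i j)^*%R = 0.
Proof.
have [_ _ vV _] := rad_orthonormal_blocks hrad.
rewrite unitary_dot // -[_ *m rsubmx V]trmxK trmx_mul trmxK.
by rewrite colE !mulmxA vV !mul0mx trmx0 mxE rmorph0.
Qed.

Lemma ritz_coord_norm (j : 'I_m) : \sum_i y i j * (y i j)^*%R = 1.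
Proof.
have colE2 (W : 'M[R]_(n.+1, m)) :
    ((col j W)^T *m col j W) 0 0 = (W^T *m W) j j.
  by rewrite !mxE; apply: eq_bigr => k _; rewrite !mxE.
by rewrite unitary_dot // colE2 ritz_orthonormal mxE eqxx.
Qed.

Lemma residual_coord_norm : \sum_i d i * (d i)^*%R = 1.
Proof.
have [_ _ _ vv] := rad_orthonormal_blocks hrad.
by rewrite unitary_dot // vv mxE.
Qed.

Lemma start_coord (i : 'I_n.+1) :
  (P *m toC (Vm *m e1 R m)) i 0 = \sum_j y i j * (beta j 0)%:C.
Proof.
have -> : Vm *m e1 R m = Y *m beta.
  by rewrite -!mulmxA (mulmxA U) (mulmx1C hU) mul1mx.
rewrite map_mxM mulmxA mxE; apply: eq_bigr => j _.
congr (_ * _); last by rewrite mxE.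
by rewrite map_col [in RHS]colE [in RHS]mulmxA -[in RHS]colE [RHS]mxE.
Qed.

(** A Ritz value is a Rayleigh quotient, hence a weighted mean of the
    eigenvalues of [A]. *)
Lemma ritz_value_range (lo hi : R) :
  (forall i, lo <= l i <= hi) -> forall j, lo <= theta 0 j <= hi.
Proof.
move=> hl j.
have thetaE : (theta 0 j)%:C = \sum_i (l i)%:C * (y i j * (y i j)^*%R).
  transitivity (\sum_i ((theta 0 j)%:C * (y i j * (y i j)^*%R)
      + (alpha 0 j)%:C * (d i * (y i j)^*%R))); last first.
    apply: eq_bigr => i _; have := ritz_residual_coord i j.
    rewrite mulrBl => /eqP; rewrite subr_eq => /eqP yE.
    by rewrite [RHS]mulrA yE mulrDl; ring.
  rewrite big_split /= -!mulr_sumr ritz_coord_norm residual_coord_dotC.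
  by rewrite mulr1 mulr0 addr0.
rewrite -!lecR thetaE -[lo%:C]mulr1 -[hi%:C]mulr1 -(ritz_coord_norm j).
rewrite !mulr_sumr; apply/andP; split; apply: ler_sum => i _;
  apply: ler_wpM2r; rewrite ?mul_conjC_ge0 // lecR; by case/andP: (hl i).
Qed.

(** If all eigenvalues were equal then so would be the Ritz values, and the
    residual direction, of norm 1, would have only zero coordinates. *)
Lemma spectrum_nondegenerate (lo hi : R) :
  (forall i, lo <= l i <= hi) -> lo < hi.
Proof.
move=> hl; have /andP[lo0 hi0] := hl 0.
rewrite lt_neqAle (le_trans lo0 hi0) andbT; apply/eqP => lohi.
have [j0] : 'I_m by exact: Ordinal m_gt0.
move=> j0m; pose j := Ordinal j0m.
have d0 i : d i = 0.
  have := ritz_residual_coord i j.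
  have -> : l i = theta 0 j.
    have := hl i; have := ritz_value_range hl j; rewrite -lohi.
    by move/le_anti <-; move/le_anti <-.
  rewrite subrr mul0r => /esym/eqP; rewrite mulf_eq0 => /orP[/eqP//|].
  by rewrite fmorph_eq0 (negPf (alpha_neq0 j)).
have := residual_coord_norm.
rewrite big1 => [/eqP|i _]; last by rewrite d0 mul0r.
by rewrite eq_sym oner_eq0.
Qed.

Lemma mxfun_quad_ritz (f : R[i] -> R[i]) :
  mxfun_quad f Am (e1 R m) =
    \sum_j f (theta 0 j)%:C * (beta j 0)%:C ^+ 2.
Proof.
have UU : toC U^T *m toC U = 1%:M by rewrite -map_mxM hU map_mx1.
rewrite (mxfun_quad_diag f (P := toC U^T) (d := toC theta)).
- apply: eq_bigr => j _; rewrite -map_mxM ![(toC _) _ _]mxE.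
  by rewrite conj_real_complex expr2.
- apply/symmetricmxP; rewrite !trmx_mul trmxK mulmxA.
  by move/symmetricmxP: hA => ->.
- by apply/unitarymxP; rewrite map_trmx trmxK toC_conj.
- by rewrite hAm map_trmx trmxK toC_conj !map_mxM map_diag_mx.
Qed.

(** The exact error formula: up to the factor [|b|^2] the error is
    [v^T gm(A) v], with [v] the last basis vector. *)
Lemma rational_krylov_error (f : R[i] -> R[i]) : b != 0 ->
  mxfun_quad f A b - (norm2 b ^+ 2)%:C * mxfun_quad f Am (e1 R m) =
  (norm2 b ^+ 2)%:C * \sum_i d i * (d i)^*%R *
    gm f (fun j => (alpha 0 j)%:C) (fun j => (beta j 0)%:C)
      (fun j => (theta 0 j)%:C) (l i)%:C.
Proof.
move=> b0.
rewrite {1}(rad_start m_gt0 b0 hrad) mxfun_quadZ -mulrBr; congr (_ * _).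
rewrite (mxfun_quad_diag f _ hA uP PE) mxfun_quad_ritz.
have rC (x : R) : x%:C \is Num.real by apply/complex_realP; exists x.
rewrite -(spectral_error_sum f (y := fun i j => y i j)) //.
- congr (_ - _); apply: eq_bigr => i _.
  by rewrite start_coord mxE.
- by move=> j; rewrite fmorph_eq0 alpha_neq0.
- by move=> j k /complexI/theta_inj.
- exact: ritz_residual_coord.
- exact: residual_coord_dot.
- exact: ritz_coord_norm.
Qed.
End RationalArnoldi.

(** * The two-sided bound *)

Theorem theorem4p8 (R : realType) (n m : nat)
    (A : 'M[R]_n.+1) (b : 'cV[R]_n.+1) (lmin lmax : R) (f : R[i] -> R[i])
    (xi : 'I_m -> option R) (V : 'M[R]_(n.+1, m + 1))
    (K H : 'M[R]_(m + 1, m)) (U : 'M[R]_m) (theta : 'rV[R]_m)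
    (hm : (0 < m)%N)
    (hA : A \is symmetricmx)
    (hspec : forall a : R, eigenvalue A a -> lmin <= a <= lmax)
    (hb : b != 0)
    (hf : analytic_around [set x%:C | x in `[lmin, lmax]] f)
    (hfreal : forall x : R, lmin <= x <= lmax -> f x%:C \is Num.real)
    (hxi : forall (i : 'I_m) (x : R), xi i = Some x ->
             x != 0 /\ ~~ eigenvalue A x)
    (hxi_last : forall i : 'I_m, i.+1 = m -> xi i = None)
    (hrad : rat_arnoldi_decomp A b xi V K H) :
  let Vm := lsubmx V in
  let Km := usubmx K in
  let h := dsubmx H in
  let Am := Vm^T *m A *m Vm in
  forall (hU : U^T *m U = 1%:M)
    (hAm : Am = U *m diag_mx theta *m U^T),
  let alpha := h *m invmx Km *m U in
  let beta := U^T *m e1 R m in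
  let g := gm f (fun j => (alpha 0 j)%:C) (fun j => (beta j 0)%:C)
              (fun j => (theta 0 j)%:C) in
  let psi := mxfun_quad f A b in
  let psi_m := (norm2 b ^+ 2)%:C * mxfun_quad f Am (e1 R m) in
  exists zmin zmax : R,
    [/\ lmin <= zmin <= lmax, lmin <= zmax <= lmax,
        forall z : R, lmin <= z <= lmax ->
          `|g zmin%:C| <= `|g z%:C| <= `|g zmax%:C| &
        (norm2 b ^+ 2)%:C * `|g zmin%:C| <= `|psi - psi_m|
          <= (norm2 b ^+ 2)%:C * `|g zmax%:C|].
Proof.
move=> Vm Km h Am hU hAm alpha beta g psi psi_m.
have [l leig lE] := spectral_diag_toC hA.
pose P := spectralmx (toC A).
have uP : P \is unitarymx by exact: spectral_unitarymx.
have PE : toC A = P ^t* *m diag_mx (\row_i (l i)%:C) *m P.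
  have := orthomx_spectralP (hermitian_normalmx (hermsymmx_toC hA)).
  rewrite -/P invmx_unitary // => {1}->; congr (_ *m diag_mx _ *m _).
  by apply/rowP => i; rewrite mxE lE.
have hl i : lmin <= l i <= lmax := hspec _ (leig i).
have lt := spectrum_nondegenerate hm hxi hrad hU hAm uP PE hl.
have htheta := ritz_value_range hrad hU hAm uP PE hl.
have err := rational_krylov_error hm hA hxi hrad hU hAm uP PE f hb.
pose G x := complex.Re (g x%:C).
have gG x : lmin <= x <= lmax -> g x%:C = (G x)%:C.
  move=> xI; rewrite /G RRe_real //.
  exact: (gm_real lt hf hfreal (fun j => alpha 0 j) (fun j => beta j 0)
    htheta xI).
have cG : {within `[lmin, lmax], continuous G} by
  exact: (@Re_gm_continuous R lmin lmax f hf m (fun j => alpha 0 j)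
    (fun j => beta j 0) _ htheta).
pose d i := (P *m toC (rsubmx V)) i 0.
pose w i := complex.Re (d i * (d i)^*%R).
have wE i : d i * (d i)^*%R = (w i)%:C.
  by rewrite /w RRe_real // ger0_real // mul_conjC_ge0.
have w0 i : 0 <= w i by rewrite -lecR -wE mul_conjC_ge0.
have w1 : \sum_i w i = 1.
  apply: (@complexI R); rewrite rmorph_sum /= rmorph1.
  by rewrite -(residual_coord_norm hrad uP); apply: eq_bigr => i _; rewrite wE.
have [z0 z0I Gz0] := continuous_weighted_mean (ltW lt) cG w0 w1 hl.
have psiE : `|psi - psi_m| = (norm2 b ^+ 2)%:C * `|g z0%:C|.
  rewrite /psi /psi_m err normrM normr_real_complex.
  rewrite [X in X%:C]ger0_norm ?sqr_ge0 //.
  congr (_ * `|_|); rewrite gG // Gz0 rmorph_sum /=; apply: eq_bigr => i _.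
  by rewrite rmorphM /= -wE -gG.
clearbody psi psi_m G g.
have cnG : {within `[lmin, lmax], continuous (fun x => `|G x|)}.
  move=> x; apply: continuous_comp; [exact: cG | exact: norm_continuous].
have [zmin zminI hmin] := EVT_min (ltW lt) cnG.
have [zmax zmaxI hmax] := EVT_max (ltW lt) cnG.
move: zminI zmaxI; rewrite !in_itv /= => zminI zmaxI.
have ext z : lmin <= z <= lmax -> `|g zmin%:C| <= `|g z%:C| <= `|g zmax%:C|.
  move=> zI; rewrite !gG // !normr_real_complex !lecR.
  by rewrite hmin ?hmax // in_itv.
exists zmin, zmax; split => //; rewrite psiE.
have /andP[le1 le2] := ext _ z0I.
by apply/andP; split; apply: ler_wpM2l => //; rewrite lecR sqr_ge0.
Qed.
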